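(* Suppose $q>0$. Let $\tilde H\in\mathbb{R}^{\mathcal I_N\times\mathcal I_N}$ be strictly lower triangular and let $\tau>0$. Let $\Lambda\in\mathbb{R}^{N\times N}$ be invertible and define $$\Phi=(\bar P\Lambda\bar P)^{-1},\qquad \mathcal R=\begin{bmatrix}\Lambda_UP&0&0\\0&0&1\\0&1&0\end{bmatrix}.$$ Then $$\mathcal L^{\mathrm{G,G}}_{\Lambda_U,\tilde H}=\mathcal R\,\mathcal L^{\mathrm{D,D}}_{\Phi_V,\tilde H^A}\,\mathcal R^\intercal,$$ and $\Lambda_U$ is an unsigned certificate for (G,G) convergence of $\tilde H$ with rate $\tau$ if and only if $\Phi_V$ is an unsigned certificate for (D,D) convergence of $\tilde H^A$ with rate $\tau$. Moreover, if $\Lambda$ is symmetric then $\Phi$ is also symmetric.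
   Context: $N\ge1$ is an integer, $\mathcal I_N=\{0,\dots,N\}$ indexes rows/columns, $e_0,\dots,e_N$ is the standard basis, $\mathbb{1}$ the all-ones vector. $S\in\mathbb{R}^{\mathcal I_N\times\mathcal I_N}$ has ones on and below the diagonal and zeros elsewhere, $R$ is the reversal permutation matrix, $P=SR$; $\bar S,\bar R,\bar P=\bar S\bar R$ are the $N\times N$ analogues. The antitranspose is $X^A=RX^\intercal R$, and $\mathrm{sym}(X)=\frac12(X+X^\intercal)$. Let $U=\begin{bmatrix}-\mathbb{1}_N^\intercal\\ I_N\end{bmatrix}$, $V=\begin{bmatrix}I_N\\0^\intercal\end{bmatrix}$ (both maps $\mathbb{R}^N\to\mathbb{R}^{\mathcal I_N}$), and for $\Lambda\in\mathbb{R}^{N\times N}$ let $\Lambda_U=U\Lambda U^\intercal$, $\Lambda_V=V\Lambda V^\intercal$. For strictly lower triangular $\tilde H$ put $H=(S^{-1}+\tilde H)((1+q)I+qS\tilde H)^{-1}$, $v_H=(I-qSH)\mathbb{1}$, $\eta_H=e_N^\intercal v_H$. For $\tau>0$ and $\Gamma\in\mathbb{R}^{\mathcal I_N\times\mathcal I_N}$ the lifted slack matrices are the symmetric block matrices $$\mathcal L_{\Gamma,\tilde H}=\begin{bmatrix}-2\,\mathrm{sym}(\Gamma A)&\Gamma b&w\\ \cdot&\tau&\zeta\\ \cdot&\cdot&\tau\end{bmatrix},$$ where for $\mathcal L^{\mathrm{G,G}}$: $A=SH+\frac1qv_He_0^\intercal$, $b=(1+\frac1q)v_H$, $w=(I-qSH)^\intercal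 e_N-\eta_He_0$, $\zeta=(1+q)\eta_H$; and for $\mathcal L^{\mathrm{D,D}}$: $A=SH$, $b=v_H$, $w=(I-(1+q)SH)^\intercal e_N$, $\zeta=(1+q)\eta_H$. For $\mathcal L_{\Phi_V,\tilde H^A}$ the matrix $H$ is the one built from $\tilde H^A$. Unsigned certificates: elements of $\mathbb{R}^d$ are row vectors. Given $y_0\in\mathbb{R}^d$, $\mathbf g\in\mathbb{R}^{\mathcal I_N\times d}$, let $\mathbf x=-SH\mathbf g+v_Hy_0$, $\mathbf s=\mathbf g+q\mathbf x$, $\mathbf y=\mathbf x+\mathbf s$, with rows $x_i,s_i,y_i$ (row $0$ of $\mathbf y$ is $y_0$). $\Gamma\in\mathbb{R}^{\mathcal I_N\times\mathcal I_N}$ is an unsigned certificate for (G,G) (resp. (D,D)) convergence of $\tilde H$ with rate $\tau$ if $\frac\tau2\|s_0\|^2-\frac1{2\tau}\|s_N\|^2+\mathrm{tr}(\mathbf g^\intercal\Gamma\mathbf x)\ge0$ (resp. $\frac\tau2\|y_0\|^2-\frac1{2\tau}\|y_N\|^2+\mathrm{tr}(\mathbf g^\intercal\Gamma\mathbf x)\ge0$) for all $(y_0,\mathbf g)$; in the operator setting ($\frac{1-\mu}{1+\mu}$-contractive operators, $q=\mu/(1-\mu)$), as opposed to the function setting ($1$-smooth $\mu$-strongly convex functions), $\Gamma$ is additionally required to be symmetric. The claim holds in both settings. *)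

(* Defs.v *)
From mathcomp Require Import all_boot all_order all_algebra.
From mathcomp Require Import reals.
Set Implicit Arguments.
Unset Strict Implicit.
Unset Printing Implicit Defensive.
Import Order.TTheory GRing.Theory Num.Theory.
Local Open Scope ring_scope.

(* The index set {0, ..., N} is 'I_N.+1; e_0 and e_N are [ebas ord0] and
   [ebas ord_max].  Matrices parametrized by n : nat are used both at n = N.+1
   (S, R, P) and at n = N (their barred analogues). *)
Definition ebas {R : realType} {n : nat} (i : 'I_n) : 'cV[R]_n := delta_mx i 0.

Definition ones {R : realType} {n : nat} : 'cV[R]_n := const_mx 1.

Definition Smx {R : realType} {n : nat} : 'M[R]_n :=
  \matrix_(i < n, j < n) (j <= i)%N%:R.

Definition revmx {R : realType} {n : nat} : 'M[R]_n :=
  \matrix_(i < n, j < n) (j == rev_ord i)%:R.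

Definition Pmx {R : realType} {n : nat} : 'M[R]_n := Smx *m revmx.

Definition antitr {R : realType} {n : nat} (X : 'M[R]_n) : 'M[R]_n :=
  revmx *m X^T *m revmx.

Definition sym {R : realType} {n : nat} (X : 'M[R]_n) : 'M[R]_n :=
  2^-1 *: (X + X^T).

Definition Umx {R : realType} {N : nat} : 'M[R]_(N.+1, N) :=
  col_mx (- const_mx 1 : 'M[R]_(1, N)) (1%:M : 'M[R]_N).

(* [pid_mx N] of height N.+1 and width N: the identity above a zero row. *)
Definition Vmx {R : realType} {N : nat} : 'M[R]_(N.+1, N) := pid_mx N.

Definition liftU {R : realType} {N : nat} (L : 'M[R]_N) : 'M[R]_N.+1 :=
  Umx *m L *m Umx^T.

Definition liftV {R : realType} {N : nat} (L : 'M[R]_N) : 'M[R]_N.+1 :=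
  Vmx *m L *m Vmx^T.

Definition strictly_lower {R : realType} {n : nat} (X : 'M[R]_n) : Prop :=
  forall i j : 'I_n, (i <= j)%N -> X i j = 0.

(* For strictly lower triangular Ht and q > 0, the matrix inverted here is lower
   triangular with diagonal entries 1 + q, hence invertible. *)
Definition Hof {R : realType} {N : nat} (q : R) (Ht : 'M[R]_N.+1) : 'M[R]_N.+1 :=
  (invmx Smx + Ht) *m invmx ((1 + q)%:M + q *: (Smx *m Ht)).

Definition vof {R : realType} {N : nat} (q : R) (H : 'M[R]_N.+1) : 'cV[R]_N.+1 :=
  (1%:M - q *: (Smx *m H)) *m ones.

Definition etaof {R : realType} {N : nat} (q : R) (H : 'M[R]_N.+1) : R :=
  ((ebas ord_max)^T *m vof q H) 0 0.

Definition slack {R : realType} {N : nat} (tau : R) (Gam A : 'M[R]_N.+1)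
    (b w : 'cV[R]_N.+1) (zeta : R) : 'M[R]_(N.+1 + (1 + 1)) :=
  block_mx (- (2 *: sym (Gam *m A))) (row_mx (Gam *m b) w)
           (row_mx (Gam *m b) w)^T
           (block_mx tau%:M zeta%:M zeta%:M tau%:M).

Definition slackGG {R : realType} {N : nat} (q tau : R) (Gam Ht : 'M[R]_N.+1) :
    'M[R]_(N.+1 + (1 + 1)) :=
  let H := Hof q Ht in
  slack tau Gam
    (Smx *m H + q^-1 *: (vof q H *m (ebas ord0)^T))
    ((1 + q^-1) *: vof q H)
    ((1%:M - q *: (Smx *m H))^T *m ebas ord_max - etaof q H *: ebas ord0)
    ((1 + q) * etaof q H).

Definition slackDD {R : realType} {N : nat} (q tau : R) (Gam Ht : 'M[R]_N.+1) :
    'M[R]_(N.+1 + (1 + 1)) :=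
  let H := Hof q Ht in
  slack tau Gam
    (Smx *m H)
    (vof q H)
    ((1%:M - (1 + q) *: (Smx *m H))^T *m ebas ord_max)
    ((1 + q) * etaof q H).

(* Euclidean norm; the norm of the normed-module structure on matrices is the sup norm. *)
Definition sqnorm {R : realType} {d : nat} (v : 'rV[R]_d) : R :=
  \sum_(j < d) v 0 j ^+ 2.

Definition xof {R : realType} {N d : nat} (q : R) (Ht : 'M[R]_N.+1)
    (y0 : 'rV[R]_d) (g : 'M[R]_(N.+1, d)) : 'M[R]_(N.+1, d) :=
  - (Smx *m Hof q Ht *m g) + vof q (Hof q Ht) *m y0.

Definition sof {R : realType} {N d : nat} (q : R) (Ht : 'M[R]_N.+1)
    (y0 : 'rV[R]_d) (g : 'M[R]_(N.+1, d)) : 'M[R]_(N.+1, d) :=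
  g + q *: xof q Ht y0 g.

Definition yof {R : realType} {N d : nat} (q : R) (Ht : 'M[R]_N.+1)
    (y0 : 'rV[R]_d) (g : 'M[R]_(N.+1, d)) : 'M[R]_(N.+1, d) :=
  xof q Ht y0 g + sof q Ht y0 g.

(* Contractive operators or smooth strongly convex functions; for certificates the
   two settings differ only in whether the multiplier matrix must be symmetric. *)
Inductive setting := OperatorSetting | FunctionSetting.

Definition setting_ok {R : realType} {n : nat} (st : setting) (Gam : 'M[R]_n) :
    Prop :=
  match st with
  | OperatorSetting => Gam^T = Gam
  | FunctionSetting => True
  end.

Definition certificateGG {R : realType} {N : nat} (st : setting) (d : nat)
    (q tau : R) (Ht Gam : 'M[R]_N.+1) : Prop :=
  setting_ok st Gam /\
  forall (y0 : 'rV[R]_d) (g : 'M[R]_(N.+1, d)),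
    0 <= tau / 2 * sqnorm (row ord0 (sof q Ht y0 g))
         - (2 * tau)^-1 * sqnorm (row ord_max (sof q Ht y0 g))
         + \tr (g^T *m Gam *m xof q Ht y0 g).

(* Row 0 of [yof q Ht y0 g] is y0 for strictly lower triangular Ht and q > 0. *)
Definition certificateDD {R : realType} {N : nat} (st : setting) (d : nat)
    (q tau : R) (Ht Gam : 'M[R]_N.+1) : Prop :=
  setting_ok st Gam /\
  forall (y0 : 'rV[R]_d) (g : 'M[R]_(N.+1, d)),
    0 <= tau / 2 * sqnorm y0
         - (2 * tau)^-1 * sqnorm (row ord_max (yof q Ht y0 g))
         + \tr (g^T *m Gam *m xof q Ht y0 g).

Definition transfer {R : realType} {N : nat} (Lam : 'M[R]_N) :
    'M[R]_(N.+1 + (1 + 1)) :=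
  block_mx (liftU Lam *m Pmx) 0 0 (block_mx 0 1%:M 1%:M 0).

(* Main.v *)
Require Import Defs.
From mathcomp Require Import all_boot all_order all_algebra.
From mathcomp Require Import reals.
From mathcomp Require Import ring zify.
Set Implicit Arguments.
Unset Strict Implicit.
Unset Printing Implicit Defensive.
Import Order.TTheory GRing.Theory Num.Theory.
Local Open Scope ring_scope.

(** Write K for the inverse of (1 + q) I + q S Ht.  Since H (1+q + q S Ht) is
    S^-1 + Ht, one gets I - q S H = K, so everything in the two slack matrices
    is an affine expression in K.  Three facts then carry the theorem.

    - Duality of the step-size matrices ([resolvent_antitr]).  P = S R is
      symmetric and conjugation by P turns S Ht^A into (S Ht)^T; hence the
      matrix K' belonging to Ht^A satisfies K' P = P K^T.  As P e_N = 1, the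
      roles of e_N (the output row) and 1 (the weight of y0) are exchanged.

    - An oblique projection ([liftU_Pmx_liftV_Pmx]).  U^T P V is the smaller
      matrix P, and Phi is chosen so that Lambda cancels:
      Lambda_U P Phi_V P = U (V^T P U)^-1 V^T P = I - e_0 1^T, the projection
      onto the range of U (the orthogonal complement of 1) along e_0.  With
      Lambda_U 1 = 0 this gives the four block identities behind
      [slackGG_congr].  The permutation of the last two coordinates in the
      congruence is the exchange of the input and the output of the method.

    - Certificates are semidefiniteness of slack matrices
      ([certificateGG_slack], [certificateDD_slack]): minus |r|^2 / (2 tau) is
      the minimum over a of tau |a|^2 / 2 + <a, r>.  With r the output row, the
      auxiliary vector a accounts for the last row and column of the slack
      matrix.

    The congruence transports nonnegativity from (D,D) to (G,G) at once.  For
    the converse the transfer matrix is singular, of corank one, but the (D,D)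
    slack matrix annihilates the missing direction (e_N, 0, 0)
    ([slackDD_kervec]), because the last row and column of Phi_V vanish and
    K' e_N = e_N / (1 + q); so a one-sided inverse modulo that direction
    ([transfer_quasi_inverse]) transports nonnegativity back. *)

(** * The reversal matrix and the symmetric matrix P *)

Lemma mul_revmx (R : realType) m n (X : 'M[R]_(m, n)) i j :
  (X *m revmx) i j = X i (rev_ord j).
Proof.
rewrite mxE (bigD1 (rev_ord j)) //= mxE rev_ordK eqxx mulr1 big1 ?addr0 // => k.
rewrite mxE => /negPf kj; rewrite -(inj_eq rev_ord_inj) rev_ordK eq_sym kj.
by rewrite mulr0.
Qed.

Lemma PmxE (R : realType) n (i j : 'I_n) :
  (Pmx i j : R) = (n <= i + j + 1)%N%:R.
Proof.
rewrite mul_revmx mxE /=; congr (_%:R); have := ltn_ord j; lia.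
Qed.

Lemma tr_revmx (R : realType) n : (revmx : 'M[R]_n)^T = revmx.
Proof.
apply/matrixP=> i j; rewrite !mxE; congr (_%:R).
by rewrite -(inj_eq rev_ord_inj) rev_ordK eq_sym.
Qed.

Lemma revmxK (R : realType) n : (revmx *m revmx : 'M[R]_n) = 1%:M.
Proof.
by apply/matrixP=> i j; rewrite mul_revmx !mxE (inj_eq rev_ord_inj) eq_sym.
Qed.

Lemma tr_Pmx (R : realType) n : (Pmx : 'M[R]_n)^T = Pmx.
Proof. by apply/matrixP=> i j; rewrite mxE !PmxE (addnC j). Qed.

Lemma Smx_unit (R : realType) n : (Smx : 'M[R]_n) \in unitmx.
Proof.
rewrite unitmxE det_trig.
  by rewrite big1 ?unitr1 // => i _; rewrite mxE leqnn.
by apply/is_trig_mxP=> i j ij; rewrite mxE leqNgt ij.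
Qed.

Lemma Pmx_unit (R : realType) n : (Pmx : 'M[R]_n) \in unitmx.
Proof.
by rewrite unitmx_mul Smx_unit (mulmx1_unit (revmxK R n)).1.
Qed.

Lemma tr_Smx (R : realType) n : (Smx : 'M[R]_n)^T = revmx *m Pmx.
Proof.
by rewrite -[in RHS]tr_Pmx /Pmx trmx_mul tr_revmx mulmxA revmxK mul1mx.
Qed.

Lemma Pmx_last (R : realType) n : Pmx *m ebas ord_max = ones :> 'cV[R]_n.+1.
Proof.
apply/matrixP=> i j; rewrite ord1 -colE mxE PmxE mxE /=.
by rewrite (_ : (_ <= _)%N) //; lia.
Qed.

(** * The lifting maps U and V *)

(** Deletion of coordinate 0, a left inverse of [Umx]. *)
Definition tailmx {R : realType} {N : nat} : 'M[R]_(N, N.+1) :=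
  row_mx (0 : 'M[R]_(N, 1)) (1%:M : 'M[R]_N).

Lemma tailmxE (R : realType) N i j :
  (tailmx : 'M[R]_(N, N.+1)) i j = (j == lift ord0 i)%:R.
Proof.
rewrite mxE -val_eqE /=; case: splitP => k jk; rewrite mxE jk.
  by rewrite ord1.
by congr (_%:R); rewrite /bump -val_eqE /=; lia.
Qed.

Lemma mul_tailmx_Umx (R : realType) N : tailmx *m Umx = 1%:M :> 'M[R]_N.
Proof. by rewrite (@mul_row_col _ _ 1) mul0mx add0r mul1mx. Qed.

Lemma Umx0E (R : realType) N j : (Umx : 'M[R]_(N.+1, N)) ord0 j = -1.
Proof. by rewrite mxE; case: splitP => k //= _; rewrite !mxE. Qed.

Lemma UmxSE (R : realType) N i j :
  (Umx : 'M[R]_(N.+1, N)) (lift ord0 i) j = (i == j)%:R.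
Proof.
rewrite mxE; case: splitP => k /=; first by rewrite (ord1 k).
by rewrite mxE => -[/val_inj->].
Qed.

Lemma tr_Umx_ones (R : realType) N : (Umx : 'M[R]_(N.+1, N))^T *m ones = 0.
Proof.
apply/matrixP=> j k; rewrite mxE [RHS]mxE.
under eq_bigr do rewrite mxE [ones _ _]mxE mulr1.
rewrite big_ord_recl Umx0E (bigD1 j) //= UmxSE eqxx.
by rewrite big1 ?addr0 ?addNr // => i /negPf ij; rewrite UmxSE ij.
Qed.

(** The oblique projection onto the range of U, the orthogonal complement of
    the all-ones vector, along e_0. *)
Lemma mul_Umx_tailmx (R : realType) N :
  Umx *m tailmx = 1%:M - ebas ord0 *m ones^T :> 'M[R]_N.+1.
Proof.
apply/matrixP=> i j; rewrite mxE [RHS]mxE [X in _ = _ + X]mxE mxE.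
rewrite [X in _ - X]mxE.
rewrite big_ord1 !mxE mulr1 !andbT.
under eq_bigr do rewrite tailmxE.
case: (unliftP ord0 j) => [j'|] ->{j}.
  rewrite (bigD1 j') //= eqxx mulr1 big1 ?addr0; last first.
    by move=> k /negPf kj; rewrite (inj_eq lift_inj) eq_sym kj mulr0.
  case: (unliftP ord0 i) => [i'|] ->{i}; first by rewrite UmxSE /= subr0.
  by rewrite Umx0E /= sub0r.
rewrite big1; last by move=> k _; rewrite mulr0.
by case: (unliftP ord0 i) => [i'|] ->{i} /=; rewrite ?subr0 ?subrr.
Qed.

Lemma mul_tr_Vmx (R : realType) N m (X : 'M[R]_(N.+1, m)) i j :
  (Vmx^T *m X) i j = X (widen_ord (leqnSn N) i) j.
Proof.
rewrite mxE (bigD1 (widen_ord (leqnSn N) i)) //= !mxE /= eqxx ltn_ord mul1r.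
rewrite big1 ?addr0 // => k; rewrite -val_eqE /= !mxE => /negPf->.
by rewrite mul0r.
Qed.

(** Row i of P has its ones in the last i + 1 columns, so dropping the last
    row amounts to forming the smaller P and prepending a zero column. *)
Lemma tr_Vmx_Pmx (R : realType) N :
  Vmx^T *m Pmx = Pmx *m tailmx :> 'M[R]_(N, N.+1).
Proof.
apply/matrixP=> i j; rewrite mul_tr_Vmx PmxE mxE /=.
under eq_bigr do rewrite tailmxE.
case: (unliftP ord0 j) => [k|] ->{j}.
  rewrite (bigD1 k) //= eqxx mulr1 big1 ?addr0; last first.
    by move=> l /negPf lk; rewrite (inj_eq lift_inj) eq_sym lk mulr0.
  by rewrite PmxE /bump /=; congr (_%:R); lia.
rewrite big1; last by move=> k _; rewrite mulr0.
by rewrite [(_ <= _)%N](_ : _ = false) //; have := ltn_ord i; rewrite /=; lia.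
Qed.

(** The orthogonal projection onto the first N coordinates. *)
Lemma mul_Vmx_tr (R : realType) N :
  Vmx *m Vmx^T = 1%:M - ebas ord_max *m (ebas ord_max)^T :> 'M[R]_N.+1.
Proof.
rewrite /Vmx tr_pid_mx mul_pid_mx !minnn.
apply/matrixP=> i j; rewrite !mxE big_ord1 !mxE !andbT -!val_eqE /=.
case: (eqVneq (i : nat) j) => [<-|/negPf ij] /=; last first.
  suff -> : (i == N :> nat)%:R * (j == N :> nat)%:R = 0 :> R.
    by rewrite subr0.
  by case: eqP => [iN|_]; rewrite ?mul0r // mul1r; case: eqP => // jN;
    by rewrite iN jN eqxx in ij.
case: (eqVneq (i : nat) N) => /= [->|/negPf iN].
  by rewrite ltnn mulr1 subrr.
by rewrite ltn_neqAle iN -ltnS ltn_ord mulr0 subr0.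
Qed.

(** * The resolvent and antitransposition *)

Definition resolvent {R : realType} {N : nat} (q : R) (Ht : 'M[R]_N.+1) :
    'M[R]_N.+1 :=
  invmx ((1 + q)%:M + q *: (Smx *m Ht)).

Section Resolvent.
Variables (R : realType) (N : nat) (q : R) (Ht : 'M[R]_N.+1).
Hypotheses (hq : 0 < q) (hHt : strictly_lower Ht).
Local Notation K := (resolvent q Ht).
Local Notation H := (Hof q Ht).

Lemma resolvent_unit : (1 + q)%:M + q *: (Smx *m Ht) \in unitmx.
Proof.
have SHt0 (i j : 'I_N.+1) : (i <= j)%N -> (Smx *m Ht) i j = 0.
  move=> ij; rewrite mxE big1 // => k _; rewrite mxE.
  by case: leqP => ki; rewrite ?mul0r // hHt ?mulr0 // (leq_trans ki).
rewrite unitmxE det_trig.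
  rewrite (eq_bigr (fun=> 1 + q)) => [|i _].
    by rewrite prodr_const unitfE expf_neq0 // gt_eqF ?addr_gt0.
  by rewrite 3!mxE eqxx mulr1n SHt0 // mulr0 addr0.
apply/is_trig_mxP=> i j ij; rewrite 3!mxE SHt0 ?(ltnW ij) // mulr0 addr0.
by rewrite -val_eqE (ltn_eqF ij).
Qed.

(** S H is (I + S Ht) times the resolvent, so the terms in S Ht cancel in
    I - q S H. *)
Lemma one_sub_qSH : 1%:M - q *: (Smx *m H) = K.
Proof.
rewrite -[LHS](mulmxK resolvent_unit) mulmxBl mul1mx -scalemxAl.
rewrite -mulmxA mulmxKV ?resolvent_unit // mulmxDr mulmxV ?Smx_unit //.
rewrite scalerDr scalemx1 opprD addrACA subrr addr0.
by rewrite -[K]mul1mx; congr (_ *m _); rewrite [(1 + q)%:M]raddfD /= addrK.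
Qed.

Lemma SHE : Smx *m H = q^-1 *: (1%:M - K).
Proof.
by rewrite -one_sub_qSH opprB addrC subrK scalerA mulVf ?gt_eqF ?scale1r.
Qed.

Lemma vofE : vof q H = K *m ones.
Proof. by rewrite /vof one_sub_qSH. Qed.

(** The last column of Ht vanishes, so e_N is an eigenvector of S Ht with
    eigenvalue 0. *)
Lemma resolvent_last : K *m ebas ord_max = (1 + q)^-1 *: ebas ord_max.
Proof.
have q1 : 1 + q != 0 by rewrite gt_eqF ?addr_gt0.
have Ht0 : Ht *m ebas ord_max = 0.
  apply/matrixP=> i j; rewrite -colE !mxE.
  by rewrite hHt // -ltnS ltn_ord.
have /mulKmx := resolvent_unit => /(_ _ (ebas ord_max)).
rewrite mulmxDl -scalemxAl -mulmxA Ht0 mulmx0 scaler0 addr0 mul_scalar_mx.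
by rewrite -scalemxAr => {2}<-; rewrite scalerA mulVf ?scale1r.
Qed.

(** Dual to the previous lemma: row 0 of S Ht vanishes. *)
Lemma resolvent_first : (ebas ord0)^T *m K = (1 + q)^-1 *: (ebas ord0)^T.
Proof.
have q1 : 1 + q != 0 by rewrite gt_eqF ?addr_gt0.
have Ht0 : (ebas ord0)^T *m (Smx *m Ht) = 0.
  apply/matrixP=> i j; rewrite trmx_delta -rowE !mxE big1 // => k _; rewrite mxE.
  by case: leqP; rewrite ?mul0r // => k0; rewrite hHt ?mulr0 // (leq_trans k0).
have /mulmxK := resolvent_unit => /(_ _ (ebas ord0)^T).
rewrite mulmxDr -scalemxAr Ht0 scaler0 addr0 mul_mx_scalar.
by rewrite -scalemxAl => {2}<-; rewrite scalerA mulVf ?scale1r.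
Qed.

End Resolvent.

Lemma antitr_strictly_lower (R : realType) n (X : 'M[R]_n) :
  strictly_lower X -> strictly_lower (antitr X).
Proof.
move=> hX i j ij; rewrite /antitr mul_revmx -[revmx]tr_revmx -trmx_mul mxE.
rewrite mul_revmx hX //=; lia.
Qed.

(** Since R S R = S^T and S R = P, one has S Ht^A P = P (S Ht)^T;
    this intertwining passes to the inverses. *)
Lemma resolvent_antitr (R : realType) N (q : R) (Ht : 'M[R]_N.+1) :
  0 < q -> strictly_lower Ht ->
  resolvent q (antitr Ht) *m Pmx = Pmx *m (resolvent q Ht)^T.
Proof.
move=> hq hHt; have hHt' := antitr_strictly_lower hHt.
have SA : Smx *m antitr Ht *m Pmx = Pmx *m (Smx *m Ht)^T.
  by rewrite trmx_mul tr_Smx /antitr !mulmxA.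
have MP : ((1 + q)%:M + q *: (Smx *m antitr Ht)) *m Pmx =
          Pmx *m ((1 + q)%:M + q *: (Smx *m Ht))^T.
  rewrite [in RHS]linearD /= tr_scalar_mx linearZ /= mulmxDl mulmxDr.
  by rewrite -scalemxAl -scalemxAr SA mul_scalar_mx mul_mx_scalar.
rewrite -[RHS](mulKmx (resolvent_unit hq hHt')) -/(resolvent _ _).
congr (_ *m _).
by rewrite mulmxA MP -mulmxA -trmx_mul mulVmx ?resolvent_unit // trmx1 mulmx1.
Qed.

Lemma etaofE (R : realType) N (q : R) (Ht : 'M[R]_N.+1) :
  0 < q -> strictly_lower Ht ->
  (etaof q (Hof q Ht))%:M = (ebas ord_max)^T *m resolvent q Ht *m ones.
Proof. by move=> hq hHt; rewrite /etaof vofE // mulmxA -mx11_scalar. Qed.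

(** Both sides are the scalar 1^T K^T e_N: the intertwining with P exchanges
    e_N and the all-ones vector, because P e_N = 1. *)
Lemma etaof_antitr (R : realType) N (q : R) (Ht : 'M[R]_N.+1) :
  0 < q -> strictly_lower Ht ->
  etaof q (Hof q (antitr Ht)) = etaof q (Hof q Ht).
Proof.
move=> hq hHt; have hHt' := antitr_strictly_lower hHt.
have inj (a b : R) : a%:M = b%:M :> 'M_1 -> a = b.
  by move=> /matrixP/(_ 0 0); rewrite !mxE eqxx.
apply: inj; rewrite !etaofE // -[in LHS]Pmx_last.
rewrite -(mulmxA (_^T)) (mulmxA (resolvent _ _)) resolvent_antitr //.
rewrite -(mulmxA Pmx) (mulmxA (_^T) Pmx) -(tr_Pmx R N.+1) -trmx_mul Pmx_last.
by rewrite -[RHS]etaofE // -[RHS]tr_scalar_mx etaofE // !trmx_mul trmxK mulmxA.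
Qed.

(** * The congruence of slack matrices *)

Section Blocks.
Variables (R : realType) (N : nat) (q : R) (Ht : 'M[R]_N.+1) (Lam : 'M[R]_N).
Hypotheses (hq : 0 < q) (hHt : strictly_lower Ht) (hLam : Lam \in unitmx).
Local Notation Phi := (invmx (Pmx *m Lam *m Pmx)).
Local Notation T := (liftU Lam *m Pmx).
Local Notation H := (Hof q Ht).
Local Notation H' := (Hof q (antitr Ht)).
Local Notation K := (resolvent q Ht).
Let hHt' := antitr_strictly_lower hHt.
Let q0 : q != 0. Proof. by rewrite gt_eqF. Qed.

Lemma tr_Umx_Pmx_Vmx : Umx^T *m Pmx *m Vmx = Pmx :> 'M[R]_N.
Proof.
rewrite -[RHS]tr_Pmx -[in RHS](mulmx1 Pmx) -mul_tailmx_Umx mulmxA -tr_Vmx_Pmx.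
by rewrite trmx_mul (trmx_mul _ Pmx) tr_Pmx trmxK (mulmxA _ Pmx).
Qed.

Lemma liftU_ones : liftU Lam *m ones = 0.
Proof. by rewrite /liftU -mulmxA tr_Umx_ones mulmx0. Qed.

(** The cancellation for which Phi is designed: U^T P V is the smaller P, so
    the middle factor Lambda P Phi is P^-1, and V^T P = P [0 I]. *)
Lemma liftU_Pmx_liftV_Pmx :
  T *m liftV Phi *m Pmx = 1%:M - ebas ord0 *m ones^T.
Proof.
have PLP : Pmx *m Lam *m Pmx \in unitmx.
  by rewrite (unitmx_mul _ Pmx) (unitmx_mul Pmx) Pmx_unit hLam.
have LPPhi : Lam *m Pmx *m Phi = invmx Pmx.
  rewrite -[LHS](mulKmx (Pmx_unit R N)) (mulmxA Pmx) (mulmxA Pmx Lam).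
  by rewrite mulmxV ?mulmx1.
(* P is itself a product, which reassociation would split open; hence the
   generalization here and the explicit arguments of mulmxA below. *)
have -> : T *m liftV Phi *m Pmx =
          Umx *m (Lam *m (Umx^T *m Pmx *m Vmx) *m Phi) *m (Vmx^T *m Pmx).
  by move: Pmx Phi => P F; rewrite /liftU /liftV !mulmxA.
rewrite tr_Umx_Pmx_Vmx tr_Vmx_Pmx LPPhi -(mulmxA Umx) (mulmxA _ Pmx).
by rewrite mulVmx ?Pmx_unit // mul1mx mul_Umx_tailmx.
Qed.

(** The duality turns P^-1 (I - K') P into (I - K)^T.  The projection then
    contributes - e_0 1^T (I - K)^T, whose transpose is K 1 e_0^T - 1 e_0^T: the
    rank-one term of the (G,G) corner, and a term killed by Lambda_U. *)
Lemma transfer_corner :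
  T *m (liftV Phi *m (Smx *m H')) *m T^T =
  (liftU Lam *m (Smx *m H + q^-1 *: (vof q H *m (ebas ord0)^T)))^T.
Proof.
have KP : (1%:M - resolvent q (antitr Ht)) *m Pmx = Pmx *m (1%:M - K)^T.
  rewrite mulmxBl mul1mx resolvent_antitr // linearB /= trmx1 mulmxBr.
  by rewrite mulmx1.
transitivity (q^-1 *: ((1%:M - ebas ord0 *m ones^T) *m (1%:M - K)^T *m
                       (liftU Lam)^T)).
  rewrite -liftU_Pmx_liftV_Pmx SHE // -[in LHS]scalemxAr -[in LHS]scalemxAr.
  rewrite -[in LHS]scalemxAl; congr (_ *: _).
  rewrite trmx_mul tr_Pmx (mulmxA _ Pmx); congr (_ *m _).
  by rewrite -(mulmxA (T *m _)) -KP (mulmxA _ _ Pmx) (mulmxA T).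
rewrite SHE // vofE // -scalerDr -scalemxAr linearZ /=; congr (_ *: _).
rewrite -[LHS]trmxK; congr (_^T).
rewrite !trmx_mul !trmxK linearB /= trmx1 trmx_mul trmxK.
rewrite mulmxBr mulmx1 (mulmxBl 1%:M) mul1mx opprB (addrC (_ *m _)) addrA.
by rewrite !mulmxDr !mulmxN !mulmxA liftU_ones mul0mx subr0.
Qed.

(** P K'^T e_N = K P e_N = K 1; the remaining term is a multiple of
    Lambda_U 1 = 0. *)
Lemma transfer_wDD :
  T *m ((1%:M - (1 + q) *: (Smx *m H'))^T *m ebas ord_max) =
  liftU Lam *m ((1 + q^-1) *: vof q H).
Proof.
have KP : Pmx *m ((resolvent q (antitr Ht))^T *m ebas ord_max) = K *m ones.
  rewrite mulmxA -[in LHS](tr_Pmx R) -trmx_mul resolvent_antitr //.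
  by rewrite trmx_mul trmxK tr_Pmx -mulmxA Pmx_last.
have -> : 1%:M - (1 + q) *: (Smx *m H') =
          q^-1 *: ((1 + q) *: resolvent q (antitr Ht) - 1%:M).
  by rewrite SHE //; apply/matrixP=> i j; rewrite !mxE; field.
have -> : (1 + q^-1) *: vof q H = q^-1 *: ((1 + q) *: (K *m ones)).
  by rewrite vofE // scalerA mulrDr mulVf // mulr1 addrC.
rewrite linearZ linearB /= linearZ /= trmx1 -scalemxAl -!scalemxAr.
congr (_ *: _); rewrite -mulmxA mulmxBl mul1mx -scalemxAl mulmxBr Pmx_last.
by rewrite -scalemxAr KP mulmxBr liftU_ones subr0 scalemxAr.
Qed.

(** K' 1 = K' P e_N = P K^T e_N, to which the oblique projection applies. *)
Lemma transfer_bDD :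
  T *m (liftV Phi *m vof q H') =
  (1%:M - q *: (Smx *m H))^T *m ebas ord_max - etaof q H *: ebas ord0.
Proof.
rewrite one_sub_qSH // vofE // -Pmx_last (mulmxA _ Pmx) resolvent_antitr //.
rewrite -(mulmxA Pmx K^T) (mulmxA T) (mulmxA _ Pmx) liftU_Pmx_liftV_Pmx.
rewrite mulmxBl mul1mx; congr (_ - _).
rewrite -mulmxA -mul_mx_scalar; congr (_ *m _).
by rewrite -tr_scalar_mx etaofE // !trmx_mul trmxK.
Qed.
End Blocks.

Lemma tr_slack (R : realType) N (tau : R) (Gam A : 'M[R]_N.+1) b w zeta :
  (slack tau Gam A b w zeta)^T = slack tau Gam A b w zeta.
Proof.
rewrite /slack tr_block_mx trmxK; congr block_mx.
  by move: (Gam *m A) => X; apply/matrixP=> i j; rewrite !mxE (addrC (X j i)).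
by rewrite tr_block_mx !tr_scalar_mx.
Qed.

(** The direction e_N of the first block, on which the (D,D) slack form does
    not depend and which the transposed transfer matrix misses. *)
Definition kervec {R : realType} {N : nat} : 'cV[R]_(N.+1 + (1 + 1)) :=
  col_mx (ebas ord_max) 0.

Lemma tr_Vmx_last (R : realType) N :
  Vmx^T *m (ebas ord_max : 'cV[R]_N.+1) = 0.
Proof.
apply/matrixP=> i j; rewrite mul_tr_Vmx !mxE -val_eqE /=.
by rewrite (ltn_eqF (ltn_ord i)).
Qed.

Section Congruence.
Variables (R : realType) (N : nat) (q tau : R).
Variables (Ht : 'M[R]_N.+1) (Lam : 'M[R]_N).
Hypotheses (hq : 0 < q) (hHt : strictly_lower Ht) (hLam : Lam \in unitmx).
Local Notation Phi := (invmx (Pmx *m Lam *m Pmx)).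

Lemma slackGG_congr :
  slackGG q tau (liftU Lam) Ht =
  transfer Lam *m slackDD q tau (liftV Phi) (antitr Ht) *m (transfer Lam)^T.
Proof.
rewrite /slackGG /slackDD /slack /transfer.
set T := liftU Lam *m Pmx.
rewrite [in RHS]tr_block_mx !trmx0 tr_block_mx !trmx0 !trmx1.
rewrite !mulmx_block !mul0mx !mulmx0 !addr0 !add0r.
rewrite mul_mx_row mul_row_block !mulmx0 !mulmx1 add0r addr0.
rewrite transfer_wDD // transfer_bDD // etaof_antitr //.
congr block_mx.
- rewrite mulmxN mulNmx -scalemxAr -scalemxAl; congr (- (2 *: _)).
  rewrite /sym -scalemxAr -scalemxAl; congr (_ *: _).
  rewrite (mulmxDr T) mulmxDl transfer_corner // addrC; congr (_ + _).
  by rewrite -[LHS]trmxK -transfer_corner // !trmx_mul !trmxK !mulmxA.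
- rewrite tr_row_mx [in RHS]tr_row_mx mul_block_col !mul0mx !mul1mx add0r addr0.
  rewrite mul_col_mx -!trmx_mul.
  by rewrite transfer_wDD // transfer_bDD // etaof_antitr.
- by rewrite !mul1mx mulmx_block !mulmx0 !mulmx1 !add0r !addr0.
Qed.

(** The last gradient does not enter the (D,D) inequality: among the x_i it
    affects only x_N, the last row and column of Phi_V vanish, and the
    coefficient of g_N in y_N is 1 - (1 + q) / (1 + q) = 0. *)
Lemma slackDD_kervec (F : 'M[R]_N) :
  slackDD q tau (liftV F) Ht *m kervec = 0.
Proof.
have GN : liftV F *m ebas ord_max = 0 by rewrite -mulmxA tr_Vmx_last mulmx0.
have GTN : (liftV F)^T *m ebas ord_max = 0.
  by rewrite /liftV !trmx_mul trmxK -!mulmxA tr_Vmx_last !mulmx0.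
have q1 : 1 + q != 0 by rewrite gt_eqF ?addr_gt0.
have q0 : q != 0 by rewrite gt_eqF.
have AN : Smx *m Hof q Ht *m ebas ord_max = (1 + q)^-1 *: ebas ord_max.
  rewrite SHE // -scalemxAl mulmxBl mul1mx resolvent_last //.
  by apply/matrixP=> i j; rewrite !mxE; field; rewrite q0 q1.
rewrite /slackDD /slack /kervec mul_block_col !mulmx0 !addr0.
rewrite mulNmx -!scalemxAl mulmxDl -mulmxA AN -scalemxAr GN trmx_mul -mulmxA GTN.
rewrite mulmx0 !scaler0 addr0 !scaler0 oppr0 tr_row_mx mul_col_mx.
rewrite [(liftV F *m _)^T]trmx_mul -mulmxA GTN mulmx0 trmx_mul trmxK -mulmxA.
rewrite mulmxBl mul1mx -scalemxAl AN scalerA mulfV // scale1r subrr mulmx0.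
by rewrite !col_mx0.
Qed.

(** As P U is V times the smaller P, the range of
    (Lambda_U P)^T = P U Lambda^T U^T consists of the vectors supported on the
    first N coordinates.  The quasi-inverse reads off these coordinates,
    inverts P Lambda^T, and lifts back with a section of U^T. *)
Definition quasi_inverse : 'M[R]_(N.+1 + (1 + 1)) :=
  block_mx (tailmx^T *m invmx (Pmx *m Lam^T) *m Vmx^T) 0 0
           (block_mx 0 1%:M 1%:M 0).

Lemma transfer_quasi_inverse :
  (transfer Lam)^T *m quasi_inverse = 1%:M - kervec *m kervec^T.
Proof.
have UW : Umx^T *m tailmx^T = 1%:M :> 'M[R]_N.
  by rewrite -trmx_mul mul_tailmx_Umx trmx1.
have VPU : Vmx^T *m Pmx *m Umx = Pmx :> 'M[R]_N.
  by rewrite tr_Vmx_Pmx -mulmxA mul_tailmx_Umx mulmx1.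
have ePU : (ebas ord_max)^T *m Pmx *m Umx = 0 :> 'M[R]_(1, N).
  rewrite -[Pmx]tr_Pmx -trmx_mul Pmx_last -[LHS]trmxK trmx_mul trmxK.
  by rewrite tr_Umx_ones trmx0.
have PU : Pmx *m Umx = Vmx *m Pmx :> 'M[R]_(N.+1, N).
  rewrite -[LHS]mul1mx -[1%:M](subrK (ebas ord_max *m (ebas ord_max)^T)).
  rewrite -mul_Vmx_tr mulmxDl -(mulmxA Vmx) -(mulmxA (ebas ord_max)).
  rewrite (mulmxA Vmx^T Pmx) (mulmxA _^T Pmx) VPU ePU.
  by rewrite mulmx0 addr0.
have PL : Pmx *m Lam^T \in unitmx by rewrite (unitmx_mul Pmx) Pmx_unit unitmx_tr.
have trU : (liftU Lam)^T = Umx *m (Lam^T *m Umx^T).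
  by rewrite /liftU !trmx_mul trmxK.
have corner : (liftU Lam *m Pmx)^T *m
    (tailmx^T *m invmx (Pmx *m Lam^T) *m Vmx^T) =
    1%:M - ebas ord_max *m (ebas ord_max)^T.
  rewrite trmx_mul tr_Pmx -mul_Vmx_tr (mulmxA _ _ Vmx^T); congr (_ *m _).
  rewrite trU (mulmxA Pmx) PU -mulmxA (mulmxA _ tailmx^T) -(mulmxA Lam^T) UW.
  by rewrite mulmx1 (mulmxA _ Lam^T) -(mulmxA Vmx Pmx) mulmxK.
rewrite /transfer /quasi_inverse /kervec.
rewrite !tr_block_mx !trmx0 !trmx1 !mulmx_block !mul0mx !mulmx0 !addr0 !add0r.
rewrite corner tr_col_mx mul_col_row !mul0mx !trmx0 !mulmx0.
rewrite !mul1mx -scalar_mx_block [in RHS]scalar_mx_block opp_block_mx.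
by rewrite add_block_mx !oppr0 !addr0.
Qed.
End Congruence.

(** * Nonnegative forms and certificates *)

(** Positive semidefiniteness tested on d-dimensional vectors; d is kept as a
    parameter because certificates refer to a fixed dimension. *)
Definition nonneg_at {R : realType} {m : nat} (d : nat) (L : 'M[R]_m) : Prop :=
  forall Z : 'M[R]_(m, d), 0 <= \tr (Z^T *m L *m Z).

Lemma nonneg_at_congr (R : realType) m n d (L : 'M[R]_m) (X : 'M[R]_(n, m)) :
  nonneg_at d L -> nonneg_at d (X *m L *m X^T).
Proof.
by move=> L0 Z; have := L0 (X^T *m Z); rewrite trmx_mul trmxK !mulmxA.
Qed.

(** Writing D for the (D,D) matrix, Q for the quasi-inverse and k for
    [kervec], D k = 0 gives D T^T Q = D (I - k k^T) = D, and by
    symmetry D = Q^T (T D T^T) Q: each slack matrix is congruent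
    to the other although T is singular. *)
Lemma slack_nonneg_iff (R : realType) N d (q tau : R) (Ht : 'M[R]_N.+1)
    (Lam : 'M[R]_N) :
  0 < q -> strictly_lower Ht -> Lam \in unitmx ->
  nonneg_at d (slackGG q tau (liftU Lam) Ht) <->
  nonneg_at d (slackDD q tau (liftV (invmx (Pmx *m Lam *m Pmx))) (antitr Ht)).
Proof.
move=> hq hHt hLam; rewrite slackGG_congr //.
set D := slackDD _ _ _ _; set T := transfer Lam.
split=> [GG0|DD0]; last exact: nonneg_at_congr.
have DTQ : D *m (T^T *m quasi_inverse Lam) = D.
  rewrite transfer_quasi_inverse // mulmxBr mulmx1 mulmxA slackDD_kervec //.
    by rewrite mul0mx subr0.
  exact: antitr_strictly_lower.
have trD : D^T = D by apply: tr_slack.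
have QTD : (T^T *m quasi_inverse Lam)^T *m D = D.
  by rewrite -{1}trD -trmx_mul DTQ trD.
have DE : D = (quasi_inverse Lam)^T *m (T *m D *m T^T) *m quasi_inverse Lam.
  rewrite -{1}DTQ -{1}QTD.
  by rewrite trmx_mul trmxK !mulmxA.
by rewrite DE -{2}[quasi_inverse Lam]trmxK; apply: nonneg_at_congr.
Qed.

Section Certificates.
Variables (R : realType) (N d : nat).
Implicit Types (y a : 'rV[R]_d) (g : 'M[R]_(N.+1, d)).

Lemma sqnorm_ge0 y : 0 <= sqnorm y.
Proof. by apply: sumr_ge0 => j _; apply: sqr_ge0. Qed.

Lemma sqnormE y : sqnorm y = \tr (y^T *m y).
Proof. by apply: eq_bigr => j _; rewrite mxE big_ord1 mxE expr2. Qed.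

Lemma trace_dotC m (X Y : 'M[R]_(m, d)) : \tr (X^T *m Y) = \tr (Y^T *m X).
Proof. by rewrite -mxtrace_tr trmx_mul trmxK. Qed.

Lemma sqnormDZ (y a : 'rV[R]_d) (c : R) :
  sqnorm (y + c *: a) = sqnorm y + 2 * c * \tr (y^T *m a) + c ^+ 2 * sqnorm a.
Proof.
have trD : (y + c *: a)^T = y^T + c *: a^T by rewrite linearD linearZ.
rewrite !sqnormE trD mulmxDl !mulmxDr -!scalemxAl -!scalemxAr.
rewrite !mxtraceD !mxtraceZ (trace_dotC a y); ring.
Qed.

Lemma trace_sym (X : 'M[R]_N.+1) g :
  \tr (g^T *m - (2 *: sym X) *m g) = - 2 * \tr (g^T *m X *m g).
Proof.
have trX : \tr (g^T *m X^T *m g) = \tr (g^T *m X *m g).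
  by rewrite -mxtrace_tr !trmx_mul !trmxK mulmxA.
rewrite /sym scalerA mulfV ?scale1r ?pnatr_eq0 // mulmxN mulNmx mulmxDr mulmxDl.
by rewrite raddfN /= mxtraceD trX; ring.
Qed.

(** Completing the square in the auxiliary vector a. *)
Lemma slack_form (tau zeta : R) (Gam A : 'M[R]_N.+1) (b w : 'cV[R]_N.+1) g y a :
  tau != 0 ->
  let Z := col_mx g (col_mx y a) in
  \tr (Z^T *m slack tau Gam A b w zeta *m Z) =
    2 * (tau / 2 * sqnorm y - (2 * tau)^-1 * sqnorm (w^T *m g + zeta *: y)
         + \tr (g^T *m Gam *m (b *m y - A *m g)))
    + tau * sqnorm (a + tau^-1 *: (w^T *m g + zeta *: y)).
Proof.
move=> tau0 Z; rewrite /Z /slack !tr_col_mx mul_row_block mul_row_col.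
rewrite tr_row_mx mul_mx_row mul_row_col mul_row_block add_row_mx mul_row_col.
rewrite !mul_mx_scalar.
rewrite mulmxBr !mulmxDl !mxtraceD -!scalemxAl !mxtraceZ trace_sym raddfN /=.
rewrite (mulmxA (g^T *m Gam)) -!(mulmxA a^T) -!(mulmxA y^T).
have -> : \tr (y^T *m ((Gam *m b)^T *m g)) = \tr (g^T *m (Gam *m b) *m y).
  by rewrite -mxtrace_tr !trmx_mul !trmxK !mulmxA.
have -> : \tr (g^T *m w *m a) = \tr (a^T *m (w^T *m g)).
  by rewrite -mxtrace_tr !trmx_mul !trmxK.
rewrite !mulmxA; set gb := \tr (g^T *m Gam *m b *m y).
set gA := \tr (g^T *m Gam *m A *m g).
rewrite -(mulmxA a^T); set r := w^T *m g.
rewrite !sqnormDZ mulmxDr mxtraceD -scalemxAr mxtraceZ.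
rewrite (trace_dotC r) (trace_dotC y a) !sqnormE.
by field.
Qed.

(** The minimum over a is attained where the completed square vanishes, which
    eliminates a. *)
Lemma nonneg_slack (tau zeta : R) (Gam A : 'M[R]_N.+1) (b w : 'cV[R]_N.+1) :
  0 < tau ->
  nonneg_at d (slack tau Gam A b w zeta) <->
  forall g y,
    0 <= tau / 2 * sqnorm y - (2 * tau)^-1 * sqnorm (w^T *m g + zeta *: y)
         + \tr (g^T *m Gam *m (b *m y - A *m g)).
Proof.
move=> tau0; have tauN0 : tau != 0 by rewrite gt_eqF.
split=> [L0 g y|Q0 Z].
  have := L0 (col_mx g (col_mx y (- (tau^-1 *: (w^T *m g + zeta *: y))))).
  have sq0 : sqnorm (0 : 'rV[R]_d) = 0.
    by rewrite sqnormE mulmx0 mxtrace0.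
  by rewrite slack_form // addNr sq0 mulr0 addr0 pmulr_rge0.
rewrite -[Z]vsubmxK -[dsubmx Z]vsubmxK slack_form //.
by rewrite addr_ge0 ?mulr_ge0 ?sqnorm_ge0 ?(ltW tau0).
Qed.

Variables (q tau : R) (Ht Gam : 'M[R]_N.+1).
Hypotheses (hq : 0 < q) (htau : 0 < tau) (hHt : strictly_lower Ht).
Let q0 : q != 0. Proof. by rewrite gt_eqF. Qed.
Let q1 : 1 + q != 0. Proof. by rewrite gt_eqF ?addr_gt0. Qed.

Lemma row_tr_ebas m (i : 'I_m) (X : 'M[R]_(m, d)) : row i X = (ebas i)^T *m X.
Proof. by rewrite rowE trmx_delta. Qed.

(** The form in which row 0 is immediate, e_0 being a left eigenvector of the
    resolvent. *)
Lemma sofE y0 g : sof q Ht y0 g = resolvent q Ht *m (g + q *: (ones *m y0)).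
Proof.
rewrite /sof /xof vofE // mulmxDr -scalemxAr (mulmxA _ ones) scalerDr scalerN.
rewrite addrA; congr (_ + _).
by rewrite -one_sub_qSH // mulmxBl mul1mx -scalemxAl.
Qed.

Lemma row_sof_first y0 g :
  row ord0 (sof q Ht y0 g) = (1 + q)^-1 *: (row ord0 g + q *: y0).
Proof.
rewrite !row_tr_ebas sofE mulmxA resolvent_first // -scalemxAl mulmxDr -scalemxAr.
congr (_ *: (_ + _ *: _)); rewrite -[RHS]mul1mx mulmxA; congr (_ *m _).
by apply/matrixP=> i j; rewrite trmx_delta -rowE !mxE !ord1 eqxx.
Qed.

Lemma row_last_vof y :
  (ebas ord_max)^T *m (vof q (Hof q Ht) *m y) = etaof q (Hof q Ht) *: y.
Proof. by rewrite mulmxA vofE // mulmxA -etaofE // mul_scalar_mx. Qed.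

Lemma certificateDD_slack st :
  certificateDD st d q tau Ht Gam <->
  setting_ok st Gam /\ nonneg_at d (slackDD q tau Gam Ht).
Proof.
have yofN y g : row ord_max (yof q Ht y g) =
    ((1%:M - (1 + q) *: (Smx *m Hof q Ht))^T *m ebas ord_max)^T *m g +
    ((1 + q) * etaof q (Hof q Ht)) *: y.
  rewrite row_tr_ebas /yof /sof /xof trmx_mul trmxK -scalerA -row_last_vof.
  rewrite -(mulmxA _^T) (scalemxAr _ _^T) -mulmxDr; congr (_ *m _).
  rewrite mulmxBl mul1mx -scalemxAl.
  move: (Smx *m Hof q Ht *m g) (vof q (Hof q Ht) *m y) => X Y.
  by apply/matrixP=> i j; rewrite !mxE; ring.
rewrite /certificateDD /slackDD nonneg_slack //.
have xofC y g : xof q Ht y g = vof q (Hof q Ht) *m y - Smx *m Hof q Ht *m g.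
  by rewrite /xof addrC.
by split=> -[ok Q0]; split=> // u v; have := Q0 v u; rewrite yofN xofC.
Qed.

(** The slack matrix is written in terms of s_0 instead of y_0.  As
    (1 + q) s_0 = g_0 + q y_0 and q is nonzero, (y_0, g) and (s_0, g) determine
    each other; substituting for y_0 produces the rank-one corrections by e_0
    in A and w. *)
Lemma certificateGG_slack st :
  certificateGG st d q tau Ht Gam <->
  setting_ok st Gam /\ nonneg_at d (slackGG q tau Gam Ht).
Proof.
pose H := Hof q Ht.
pose A := Smx *m H + q^-1 *: (vof q H *m (ebas ord0)^T).
pose b := (1 + q^-1) *: vof q H.
pose w := (1%:M - q *: (Smx *m H))^T *m ebas ord_max - etaof q H *: ebas ord0.
have xofs y g : xof q Ht y g = b *m row ord0 (sof q Ht y g) - A *m g.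
  rewrite row_sof_first row_tr_ebas /xof -/H /b /A mulmxDl -!scalemxAl.
  rewrite -(mulmxA _ _^T g) -scalemxAr mulmxDr -scalemxAr -row_tr_ebas.
  move: (Smx *m H *m g) (vof q H *m y) (vof q H *m row ord0 g) => X Y Z.
  apply/matrixP=> i j; rewrite !mxE; field.
  by rewrite q0 q1.
have sofs y g : row ord_max (sof q Ht y g) =
    w^T *m g + ((1 + q) * etaof q H) *: row ord0 (sof q Ht y g).
  rewrite row_sof_first row_tr_ebas sofE mulmxDr -scalemxAr.
  rewrite (mulmxA _ ones) -vofE //.
  rewrite mulmxDr -scalemxAr row_last_vof -/H /w one_sub_qSH // linearB /=.
  rewrite [(_ *: ebas ord0)^T]linearZ trmx_mul trmxK mulmxBl.
  rewrite -scalemxAl -(row_tr_ebas ord0) mulmxA.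
  move: ((ebas ord_max)^T *m resolvent q Ht *m g) (row ord0 g) => X Y.
  by apply/matrixP=> i j; rewrite !mxE; field.
rewrite /certificateGG /slackGG nonneg_slack // -/H -/A -/b -/w.
split=> -[ok Q0]; split=> //; last first.
  by move=> y g; have := Q0 g (row ord0 (sof q Ht y g)); rewrite -sofs -xofs.
(* The y0 below is the one that yields the prescribed s_0. *)
move=> g s; pose y := q^-1 *: ((1 + q) *: s - row ord0 g).
have ys : row ord0 (sof q Ht y g) = s.
  rewrite row_sof_first /y scalerA mulfV // scale1r (addrC (row _ _)) subrK.
  by rewrite scalerA mulVf ?scale1r.
by have := Q0 y g; rewrite sofs xofs ys.
Qed.

End Certificates.

(** * Symmetry of the multipliers *)

Lemma tr_liftU (R : realType) N (L : 'M[R]_N) :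
  (liftU L)^T = liftU L <-> L^T = L.
Proof.
split=> [|symL]; last by rewrite /liftU !trmx_mul trmxK symL mulmxA.
have liftK (M : 'M[R]_N) : tailmx *m liftU M *m tailmx^T = M.
  rewrite /liftU !mulmxA mul_tailmx_Umx mul1mx -mulmxA -trmx_mul.
  by rewrite mul_tailmx_Umx trmx1 mulmx1.
move=> symL; rewrite -[RHS]liftK -symL.
by rewrite -{1}[L]liftK !trmx_mul trmxK mulmxA.
Qed.

Lemma tr_liftV (R : realType) N (L : 'M[R]_N) :
  (liftV L)^T = liftV L <-> L^T = L.
Proof.
have VV : Vmx^T *m Vmx = 1%:M :> 'M[R]_N.
  by rewrite tr_pid_mx mul_pid_mx minnn (minn_idPr _) // pid_mx_1.
split=> [|symL]; last by rewrite /liftV !trmx_mul trmxK symL mulmxA.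
have liftK (M : 'M[R]_N) : Vmx^T *m liftV M *m Vmx = M.
  by rewrite /liftV !mulmxA VV mul1mx -mulmxA VV mulmx1.
move=> symL; rewrite -[RHS]liftK -symL.
by rewrite -{1}[L]liftK !trmx_mul trmxK mulmxA.
Qed.

Lemma tr_dual (R : realType) N (L : 'M[R]_N) :
  (invmx (Pmx *m L *m Pmx))^T = invmx (Pmx *m L *m Pmx) <-> L^T = L.
Proof.
rewrite trmx_inv (trmx_mul _ Pmx) (trmx_mul Pmx) tr_Pmx.
rewrite (mulmxA _ _ Pmx).
split=> [E|->//].
apply: (can_inj (mulKmx (Pmx_unit R N))).
apply: (can_inj (mulmxK (Pmx_unit R N))).
exact: (can_inj (@invmxK _ _) E).
Qed.

Theorem theorem3 (R : realType) (N : nat) (hN : (1 <= N)%N)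
    (q : R) (hq : 0 < q) (tau : R) (htau : 0 < tau)
    (Ht : 'M[R]_N.+1) (hHt : strictly_lower Ht)
    (Lam : 'M[R]_N) (hLam : Lam \in unitmx) :
  let Phi : 'M[R]_N := invmx (Pmx *m Lam *m Pmx) in
  [/\ slackGG q tau (liftU Lam) Ht =
        transfer Lam *m slackDD q tau (liftV Phi) (antitr Ht) *m (transfer Lam)^T,
      forall (st : setting) (d : nat),
        certificateGG st d q tau Ht (liftU Lam) <->
        certificateDD st d q tau (antitr Ht) (liftV Phi)
    & Lam^T = Lam -> Phi^T = Phi].
Proof.
move=> Phi; split=> [|st d|]; first exact: slackGG_congr.
  have hHt' := antitr_strictly_lower hHt.
  have symE : setting_ok st (liftU Lam) <-> setting_ok st (liftV Phi).
    case: st => //=; apply: (iff_trans (tr_liftU Lam)).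
    exact: iff_trans (iff_sym (tr_dual Lam)) (iff_sym (tr_liftV Phi)).
  have nonnegE := slack_nonneg_iff d tau hq hHt hLam.
  apply: (iff_trans (certificateGG_slack d _ hq htau hHt st)).
  apply: iff_trans (iff_sym (certificateDD_slack d _ hq htau hHt' st)).
  case: symE nonnegE => s1 s2 [n1 n2].
  by split=> -[ok L0]; [exact: conj (s1 ok) (n1 L0)
                      | exact: conj (s2 ok) (n2 L0)].
by move/(tr_dual Lam).
Qed.
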